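(* If $X$ is an infinite Tychonoff space, then the free topological vector space $\mathbb{V}(X)$ contains a closed vector subspace which is topologically isomorphic to $\phi=\mathbb{V}(\mathbb{N})=L(\mathbb{N})$.
   Context: All vector spaces are over $\mathbb{R}$; all topological spaces are Tychonoff (so topological vector spaces are Hausdorff). The free topological vector space over a Tychonoff space $X$ is a topological vector space $\mathbb{V}(X)$ together with a continuous map $i:X\to\mathbb{V}(X)$ such that for every continuous map $f$ from $X$ to a topological vector space $E$ there is a unique continuous linear operator $\bar f:\mathbb{V}(X)\to E$ with $f=\bar f\circ i$. The free locally convex space $L(X)$ is defined in the same way, with ''topological vector space'' replaced by ''locally convex space'' throughout. $\mathbb{N}$ carries the discrete topology, and $\phi$ denotes $\mathbb{V}(\mathbb{N})$; it is the inductive limit of the spaces $\mathbb{R}^n$, is locally convex, and hence coincides with $L(\mathbb{N})$. ''Topologically isomorphic'' means isomorphic as topological vector spaces (linearly homeomorphic). *)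

(* Defs.v *)
From HB Require Import structures.
From mathcomp Require Import all_boot all_order all_algebra.
From mathcomp Require Import all_classical all_reals all_analysis.

Set Implicit Arguments.
Unset Strict Implicit.
Unset Printing Implicit Defensive.

Import Order.TTheory GRing.Theory Num.Theory.
Import numFieldNormedType.Exports.

Local Open Scope classical_set_scope.
Local Open Scope ring_scope.

Definition tychonoff_space (X : topologicalType) : Prop :=
  completely_regular_space X /\ hausdorff_space X.

(* [topologicalLmodType] assumes no separation axiom. *)
Definition is_tvs (R : realType) (E : topologicalLmodType R) : Prop :=
  hausdorff_space E.

(* The second conjunct is the axiom [locally_convex] of the library's [tvsType];
   stated on [topologicalLmodType] it involves no choice of uniformity. *)
Definition is_lcs (R : realType) (E : topologicalLmodType R) : Prop :=
  is_tvs E /\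
  exists2 B : set_system E, (forall b, b \in B -> convex_set b) & basis B.

(* [i : X -> F] is a free object over [X] for the class [C] of topological
   vector spaces: [F] lies in [C] and has the universal property within [C]. *)
Definition is_free_in (R : realType) (C : topologicalLmodType R -> Prop)
    (X : topologicalType) (F : topologicalLmodType R) (i : X -> F) : Prop :=
  [/\ C F, continuous i &
      forall (E : topologicalLmodType R) (f : X -> E), C E -> continuous f ->
        exists! fbar : F -> E,
          [/\ linear fbar, continuous fbar & f = fbar \o i]].

Definition is_free_tvs (R : realType) (X : topologicalType)
    (V : topologicalLmodType R) (i : X -> V) : Prop :=
  is_free_in (@is_tvs R) i.

Definition is_free_lcs (R : realType) (X : topologicalType)
    (L : topologicalLmodType R) (i : X -> L) : Prop :=
  is_free_in (@is_lcs R) i.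

Definition vector_subspace (R : realType) (V : lmodType R) (W : set V) : Prop :=
  submod_closed (mem W).

(* A linear homeomorphism [h] from [F] onto [W] with its subspace topology;
   [k] is its inverse, and only its values on [W] matter. *)
Definition topologically_isomorphic_onto (R : realType)
    (F V : topologicalLmodType R) (W : set V) : Prop :=
  exists (h : F -> V) (k : V -> F),
    [/\ linear h, continuous h, range h = W, cancel h k &
        {within W, continuous k}].

(* Main.v *)
Require Import Defs.
From HB Require Import structures.
From mathcomp Require Import all_boot all_order all_algebra.
From mathcomp Require Import all_classical all_reals all_analysis.
From mathcomp Require Import ring lra zify.

(** The free space on the natural numbers is the space of finitely supported
sequences, represented by [{poly R}], with the box topology, whose neighbourhoods
of 0 are given by arbitrary weights on the coordinates ([free_nat_box_iso]). This
is the finest vector topology on that space ([box_space_finest]), and it is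
locally convex ([free_nat_lcs]).

Hence every linear map from [phi] to [V] is continuous, and the difficulty is to
find one whose image is closed and carries a topology as fine as that of [phi].
An infinite Tychonoff space contains points [x k] with bump functions [g k] of
pairwise disjoint supports and [g k (x k) = 1] ([disjoint_bumps]). Let [v n] be
the sum of the [2^n] generators [i (x k)] with [k] in the [n]-th block of indices,
and let [W] be the span of the [v n].

The topology of [V] on [W] is bounded below by mapping [V] to one test space: the
finitely supported sequences again, with a vector topology that is not locally
convex, given by the F-seminorms with value
[r * sum_k 2^-(block k) * min (c (block k) * |a k|) 1]
at [a], where the number [r] and the sequence [c] are nonnegative and arbitrary.
Since the contribution of one coordinate is at most [r * 2^-(block k)], the map
sending [y] to the sequence of the [g k y] is continuous, whatever the sequence
[c] ([bumps_to_block_space]), and it extends to a continuous linear map [theta] on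
[V]. On the other hand [theta] maps [v n] to the indicator of the [n]-th block,
where the [2^n] small contributions add up to [min (c n * |a|) 1] for [r = 1].
Thus the restriction of [theta] to [W] detects every weight [c], that is, every
neighbourhood of the box topology ([spread_embedding]). Its range, the sequences
that are constant on each block, is closed ([closed_range_spread]); as [V] is
Hausdorff, both facts pull back along [theta]: [W] is closed, and it is
homeomorphic to [phi]. *)

Set Implicit Arguments.
Unset Strict Implicit.
Unset Printing Implicit Defensive.

Import Order.TTheory GRing.Theory Num.Theory.
Import numFieldNormedType.Exports.
Local Open Scope classical_set_scope.
Local Open Scope ring_scope.

(** * Disjoint bump functions on an infinite Tychonoff space *)

(** Separate two points of [Y] by disjoint open sets [A] and [B]. If [A] meets
[Y] in an infinite set, then [B] is split off and [A] remains. Otherwise the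
point in [A] is isolated, and it is enough to split off that point. *)
Lemma infinite_open_split {X : topologicalType} (Y : set X) :
  hausdorff_space X -> open Y -> infinite_set Y ->
  exists U Z : set X, [/\ open U, U !=set0, U `<=` Y, open Z & infinite_set Z]
    /\ Z `<=` Y /\ U `&` Z = set0.
Proof.
move=> hX oY infY.
have finC := (@accessible_finite_set_closed X).1 (hausdorff_accessible hX).
have [a Ya] : Y !=set0 by apply/infinite_setN0.
have [b [Yb ba]] : (Y `\ a) !=set0.
  exact/infinite_setN0/infinite_setD.
move: hX; rewrite open_hausdorff => /(_ a b).
have /negP/negPf nab : a == b -> False by move=> /eqP ab; apply: ba; rewrite ab.
rewrite nab => /(_ isT) [[A B]] /= [/set_mem Aa /set_mem Bb] [oA oB /eqP AB].
have [finA|infA] := pselect (finite_set (A `&` Y)).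
- have oa : open [set a].
    have -> : [set a] = (A `&` Y) `&` ~` ((A `&` Y) `\ a).
      apply/seteqP; split=> [_ ->|x [AYx nx]].
        by split=> // -[_]; apply.
      by apply: contrapT => xa; apply: nx.
    apply: openI; first exact: openI.
    by rewrite openC; exact: finC (finite_setD _ finA).
  exists [set a], (Y `\ a); split; [split=> //|split].
  + by exists a.
  + by move=> _ ->.
  + apply: openI => //; rewrite openC; apply: finC; exact: finite_set1.
  + exact: infinite_setD.
  + by move=> x [].
  + by apply/seteqP; split=> // x [-> [_]]; apply.
- exists (B `&` Y), (A `&` Y); split; [split=> //|split].
  + exact: openI.
  + by exists b.
  + exact: openI.
  + by move=> x [].
  + by apply/seteqP; split=> // x [[Bx _] [Ax _]]; rewrite -AB.
Qed.

(** Iterating the splitting of an infinite open set, always inside the infinite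
remainder. *)
Lemma disjoint_open_sequence {X : topologicalType} :
  hausdorff_space X -> infinite_set [set: X] ->
  exists U : nat -> set X,
    [/\ forall n, open (U n), forall n, U n !=set0 & trivIset setT U].
Proof.
move=> hX infX.
pose st := {Y : set X | open Y /\ infinite_set Y}.
have next (Y : st) : {UZ : set X * st |
    [/\ open UZ.1, UZ.1 !=set0, UZ.1 `<=` sval Y, sval UZ.2 `<=` sval Y
      & UZ.1 `&` sval UZ.2 = set0]}.
  apply: cid; case: Y => Y [oY iY] /=.
  have [U [Z [[oU U0 UY oZ iZ] [ZY UZ]]]] := infinite_open_split hX oY iY.
  by exists (U, exist _ Z (conj oZ iZ)).
pose Y n := iter n (fun Y => (sval (next Y)).2) (exist _ setT (conj openT infX)).
pose U n := (sval (next (Y n))).1.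
have decY m n : sval (Y (m + n)%N) `<=` sval (Y m).
  elim: n => [|n IH]; first by rewrite addn0.
  rewrite addnS; apply: subset_trans IH.
  by rewrite /Y iterS; case: (svalP (next (Y (m + n)%N))).
exists U; split=> [n|n|].
- by rewrite /U; case: (svalP (next (Y n))).
- by rewrite /U; case: (svalP (next (Y n))).
have disj m n : (m < n)%N -> U m `&` U n = set0.
  move=> mn; rewrite -(subnKC mn).
  have [_ _ _ _ U0] := svalP (next (Y m)).
  rewrite -subset0 -U0; apply: setIS.
  apply: subset_trans (decY m.+1 _); rewrite /U.
  case: (svalP (next (Y (m.+1 + (n - m.+1))%N))) => _ _ UY _ _; exact: UY.
move=> m n _ _ [x [Umx Unx]]; have [mn|nm|//] := ltngtP m n.
  by have : (U m `&` U n) x by []; rewrite disj.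
by have : (U n `&` U m) x by []; rewrite disj.
Qed.

Lemma disjoint_bumps (R : realType) (X : topologicalType) :
  tychonoff_space X -> infinite_set [set: X] ->
  exists (x : nat -> X) (g : nat -> X -> R),
    [/\ forall n, continuous (g n), forall n, g n (x n) = 1 &
        forall m n y, g m y != 0 -> g n y != 0 -> m = n].
Proof.
move=> [crX hX] infX.
have [U [oU U0 tU]] := disjoint_open_sequence hX infX.
have ex n : exists xg : X * (X -> R),
    [/\ continuous xg.2, xg.2 xg.1 = 1 & forall y, xg.2 y != 0 -> U n y].
  have [x Ux] := U0 n.
  have /crX/(_ (fun k => k Ux)) : closed (~` U n) by rewrite closedC; exact: oU.
  move=> /(@uniform_separatorP X R)[f [cf _ fx fU]].
  exists (x, fun y => 1 - f y); split=> /=.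
  - by move=> y; apply: cvgB; [exact: cvg_cst|exact: cf].
  - by rewrite (fx (f x)) ?subr0//=; exists x.
  - move=> y fy; apply: contrapT => nUy; move/eqP: fy; apply.
    by rewrite (fU (f y)) ?subrr//=; exists y.
have {}ex n := cid (ex n).
exists (fun n => (sval (ex n)).1), (fun n => (sval (ex n)).2); split=> [n|n|].
- by case: (svalP (ex n)).
- by case: (svalP (ex n)).
- move=> m n y gm gn; apply: tU => //; exists y.
  by case: (svalP (ex m)) => _ _ /(_ _ gm); case: (svalP (ex n)) => _ _ /(_ _ gn).
Qed.

(** * Vector topologies defined by F-seminorms *)

(** The homogeneity of a seminorm is weakened to the two properties of scalars
that a vector topology requires: balls are circled and absorbing. This weakness
is essential, since bounded functions such as [min (q x) 1] qualify and produce
topologies that are not locally convex. *)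
Record fseminorm {R : realType} {E : lmodType R} (q : E -> R) : Prop := {
  fseminormD : forall x y, q (x + y) <= q x + q y;
  fseminormZ : forall t x, `|t| <= 1 -> q (t *: x) <= q x;
  fseminorm_absorb : forall x e, 0 < e -> \forall t \near (0 : R), q (t *: x) < e }.

Section fseminorm_theory.
Context {R : realType} {E : lmodType R} {q : E -> R}.
Hypothesis qP : fseminorm q.

Lemma fseminorm0 : q 0 = 0.
Proof.
apply/eqP; rewrite eq_le; apply/andP; split.
  apply/ler_addgt0Pr => e e0; rewrite add0r ltW//.
  by have /nbhs_singleton := fseminorm_absorb qP 0 e0; rewrite scaler0.
by have := fseminormD qP 0 0; rewrite addr0; lra.
Qed.

Lemma fseminorm_ge0 x : 0 <= q x.
Proof.
by have := @fseminormZ _ _ _ qP 0 x; rewrite normr0 scale0r fseminorm0; apply.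
Qed.

Lemma fseminormN x : q (- x) = q x.
Proof.
have le y : q (- y) <= q y.
  by rewrite -scaleN1r; apply: (fseminormZ qP); rewrite normrN1.
by apply/le_anti; rewrite le/= -{1}[x]opprK le.
Qed.

Lemma fseminormB x y : q (x - y) <= q x + q y.
Proof. by rewrite -[q y]fseminormN; exact: (fseminormD qP). Qed.

Lemma fseminormMn x n : q (x *+ n) <= n%:R * q x.
Proof.
elim: n => [|n IH]; first by rewrite mulr0n mul0r fseminorm0.
rewrite mulrSr (le_trans (fseminormD qP _ _))//.
by rewrite -natr1 mulrDl mul1r lerD2r.
Qed.

End fseminorm_theory.

(** Directedness makes the unit balls a base of neighbourhoods of the origin, and
also absorbs constants: applied to [p = q] it yields a member above [2 * q], so
that balls of radius 1 suffice. *)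
Record fseminorm_family (R : realType) (E : lmodType R) := FSeminormFamily {
  family : set (E -> R);
  family_fseminorm : forall q, family q -> fseminorm q;
  family_nonempty : family !=set0;
  family_directed : forall p q, family p -> family q ->
    exists2 r, family r & forall x, p x + q x <= r x }.

(** An alias of [E], on which the topology defined by [P] can be declared without
interfering with other topologies on [E]. *)
Definition fspace {R : realType} {E : lmodType R} (P : fseminorm_family E) : Type
  := E.

Section fspace_topology.
Context {R : realType} {E : lmodType R} (P : fseminorm_family E).

HB.instance Definition _ := GRing.Lmodule.copy (fspace P) E.

Definition fball (q : E -> R) (x : fspace P) : set (fspace P) :=
  [set y | q (y - x) < 1].

Definition fnbhs (x : fspace P) : set_system (fspace P) :=
  [set A | exists2 q, family P q & fball q x `<=` A].

HB.instance Definition _ := hasNbhs.Build (fspace P) fnbhs.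

Lemma fball_center q x : family P q -> fball q x x.
Proof.
by move=> Pq; rewrite /fball/= subrr (fseminorm0 (family_fseminorm Pq)).
Qed.

Lemma family_double q : family P q -> exists2 r, family P r & forall x, 2 * q x <= r x.
Proof.
move=> Pq; have [r Pr qr] := family_directed Pq Pq.
by exists r => // x; rewrite mulr_natl mulr2n.
Qed.

Lemma fnbhs_filter (x : fspace P) : ProperFilter (nbhs x).
Proof.
split; first by move=> [q Pq /(_ x)]; apply; exact: fball_center.
split.
- by have [q Pq] := family_nonempty P; exists q.
- move=> A B [p Pp pA] [q Pq qB]; have [r Pr pqr] := family_directed Pp Pq.
  exists r => // y; rewrite /fball /= => ry.
  have := pqr (y - x); have := fseminorm_ge0 (family_fseminorm Pp) (y - x).
  have := fseminorm_ge0 (family_fseminorm Pq) (y - x) => q0 p0 pq.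
  by split; [apply: pA|apply: qB]; rewrite /fball/=; lra.
- by move=> A B AB [q Pq qA]; exists q => //; exact: subset_trans AB.
Qed.

Lemma fnbhs_singleton (x : fspace P) A : nbhs x A -> A x.
Proof. by move=> [q Pq]; apply; exact: fball_center. Qed.

Lemma fnbhs_nbhs (x : fspace P) A : nbhs x A -> nbhs x (nbhs^~ A).
Proof.
move=> [q Pq qA]; have [r Pr qr] := family_double Pq.
exists r => // y ry; exists r => // z rz; apply: qA.
move: ry rz; rewrite /fball/= => ry rz.
have := fseminormD (family_fseminorm Pq) (z - y) (y - x).
rewrite addrA subrK; have := qr (z - y); have := qr (y - x); lra.
Qed.

HB.instance Definition _ := Nbhs_isNbhsTopological.Build (fspace P)
  fnbhs_filter fnbhs_singleton fnbhs_nbhs.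

Lemma fspace_add_continuous : continuous (fun x : fspace P * fspace P => x.1 + x.2).
Proof.
move=> [x y] A [q Pq qA]; have [r Pr qr] := family_double Pq.
exists (fball r x, fball r y) => [|[x' y'] [/= rx ry]].
  by split; exists r.
apply: qA; move: rx ry; rewrite /fball/= => rx ry.
have := fseminormD (family_fseminorm Pq) (x' - x) (y' - y).
rewrite addrACA -opprD; have := qr (x' - x); have := qr (y' - y); lra.
Qed.

HB.instance Definition _ := PreTopologicalNmodule_isTopologicalNmodule.Build
  (fspace P) fspace_add_continuous.

Lemma family_Mn q n : family P q -> exists2 r, family P r & forall x, n%:R * q x <= r x.
Proof.
move=> Pq; elim: n => [|n [r Pr nr]].
  exists q => // x; rewrite mul0r; exact: (fseminorm_ge0 (family_fseminorm Pq)).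
have [s Ps rqs] := family_directed Pr Pq; exists s => // x.
by rewrite -natr1 mulrDl mul1r (le_trans _ (rqs x))// lerD2r.
Qed.

Lemma fspace_scale_continuous :
  continuous (fun z : R^o * fspace P => z.1 *: z.2).
Proof.
move=> [t x] A [q Pq qA]; have qF := family_fseminorm Pq.
pose N := (Num.bound (`|t| + 1)).+1.
have tN : `|t| + 1 <= N%:R.
  rewrite /N -natr1; have := @archi_boundP R (`|t| + 1).
  by rewrite addr_ge0// => /(_ isT); lra.
have N0 : 0 < N%:R :> R by rewrite ltr0n.
have [r Pr qr] := @family_Mn q (2 * N) Pq.
(* With s near t and y near x, split s y - t x = s (y - x) + (s - t) x. The
   first part is bounded by N q (y - x), as |s| <= |t| + 1 <= N; the second is
   small because x is absorbed. *)
exists ([set s | `|s - t| < 1 /\ q ((s - t) *: x) < 2^-1], fball r x) => /=.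
  split; last by exists r.
  have /nbhs_ballP[d /= d0 dP] := fseminorm_absorb qF x (ltac:(lra) : 0 < 2^-1 :> R).
  apply/nbhs_ballP; exists (Num.min d 1) => /=; first by rewrite lt_min d0 ltr01.
  move=> s; rewrite /ball/= lt_min => /andP[sd s1]; split.
    by rewrite distrC.
  by apply: dP; rewrite /ball/= sub0r normrN distrC.
move=> [s y] /= [[s1 sx] ry]; apply: qA; move: ry; rewrite /fball/= => ry.
have sN : `|s| <= N%:R.
  by have := ler_normD (s - t) t; rewrite subrK; lra.
have q1 : q (s *: (y - x)) <= N%:R * q (y - x).
  have -> : s *: (y - x) = ((s / N%:R) *: (y - x)) *+ N.
    by rewrite -scaler_nat scalerA mulrC divfK ?gt_eqF.
  rewrite (le_trans (fseminormMn qF _ _))// ler_wpM2l ?ler0n//.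
  apply: (fseminormZ qF); rewrite normrM normfV (ger0_norm (ltW N0)).
  by rewrite ler_pdivrMr// mul1r.
have -> : s *: y - t *: x = s *: (y - x) + (s - t) *: x.
  by rewrite scalerBr scalerBl addrA subrK.
have := fseminormD qF (s *: (y - x)) ((s - t) *: x).
have := qr (y - x); rewrite natrM; lra.
Qed.

HB.instance Definition _ := TopologicalNmodule_isTopologicalLmodule.Build R
  (fspace P) fspace_scale_continuous.

Lemma fspace_hausdorff :
  (forall x, (forall q, family P q -> q x < 1) -> x = 0) -> hausdorff_space (fspace P).
Proof.
move=> sep x y xy; apply/eqP; rewrite -subr_eq0; apply/eqP/sep => q Pq.
have [r Pr qr] := family_double Pq.
have [||z [xz yz]] := xy (fball r x) (fball r y); [by exists r..|].
move: xz yz; rewrite /fball/= => xz yz.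
have := fseminormB (family_fseminorm Pq) (z - y) (z - x).
rewrite opprB addrC addrA subrK.
have := qr (z - x); have := qr (z - y); lra.
Qed.

End fspace_topology.

Lemma fseminorm_scale (R : realType) (E : lmodType R) (q : E -> R) (r : R) :
  0 <= r -> fseminorm q -> fseminorm (fun x => r * q x).
Proof.
move=> r0 qP; split.
- by move=> x y; rewrite -mulrDr ler_wpM2l// (fseminormD qP).
- by move=> t x t1; rewrite ler_wpM2l// (fseminormZ qP).
- move=> x e e0; have er : 0 < e / (r + 1) by rewrite divr_gt0//; lra.
  near=> t; have : q (t *: x) < e / (r + 1).
    by near: t; exact: fseminorm_absorb qP x _ er.
  rewrite ltr_pdivlMr; last by lra.
  have := fseminorm_ge0 qP (t *: x); nra.
Unshelve. all: by end_near. Qed.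

Lemma fseminorm_min1 (R : realType) (E : lmodType R) (q : E -> R) :
  fseminorm q -> fseminorm (fun x => Num.min (q x) 1).
Proof.
move=> qP; split.
- move=> x y; have := fseminormD qP x y.
  have := fseminorm_ge0 qP x; have := fseminorm_ge0 qP y.
  by rewrite /Num.min; do 3 case: ltP => ?; lra.
- move=> t x t1; have := fseminormZ qP x t1.
  by rewrite /Num.min; do 2 case: ltP => ?; lra.
- move=> x e e0; near=> t; rewrite gt_min; apply/orP; left.
  by near: t; exact: fseminorm_absorb qP x _ e0.
Unshelve. all: by end_near. Qed.

Lemma fseminorm_norm (R : realType) : fseminorm (Num.norm : R^o -> R).
Proof.
split; first exact: ler_normD.
- by move=> t x t1; rewrite normrM ler_piMl.
- move=> x e e0; have ex : 0 < e / (`|x| + 1).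
    by rewrite divr_gt0// ltr_pwDr.
  near=> t; have : `|t| < e / (`|x| + 1) by near: t; exact: (@nbhs0_lt R R^o) ex.
  rewrite ltr_pdivlMr ?ltr_pwDr// normrM.
  by have := normr_ge0 t; nra.
Unshelve. all: by end_near. Qed.

(** * Coefficientwise sums and linear combinations *)

(** Both model spaces live on [{poly R}], the space of finitely supported
sequences, with F-seminorms that are sums of F-seminorms of the coefficients. *)
Section coefwise_sum.
Context {R : realType}.
Implicit Types (F : nat -> R -> R) (p : {poly R}).

Definition coefwise_sum F p : R := \sum_(k < size p) F k p`_k.

Lemma coefwise_sum_widen F p n : (forall k, F k 0 = 0) -> (size p <= n)%N ->
  coefwise_sum F p = \sum_(k < n) F k p`_k.
Proof.
move=> F0 pn; rewrite /coefwise_sum (big_ord_widen n (fun k => F k p`_k) pn).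
rewrite big_mkcond; apply: eq_bigr => k _; case: ltnP => // pk.
by rewrite nth_default.
Qed.

Lemma fseminorm_coefwise_sum F :
  (forall k, fseminorm (F k : R^o -> R)) -> fseminorm (coefwise_sum F).
Proof.
move=> FP; have F0 k : F k 0 = 0 by exact: fseminorm0 (FP k).
split.
- move=> p q; set n := maxn (size p) (size q).
  rewrite (coefwise_sum_widen F0 (leq_maxl (size p) (size q))) -/n.
  rewrite (coefwise_sum_widen F0 (leq_maxr (size p) (size q))) -/n.
  rewrite (coefwise_sum_widen F0 (size_polyD p q)) -/n -big_split/=.
  by apply: ler_sum => k _; rewrite coefD; exact: fseminormD (FP k) _ _.
- move=> t p t1; rewrite (coefwise_sum_widen F0 (size_scale_leq t p)).
  by apply: ler_sum => k _; rewrite coefZ; exact: fseminormZ (FP k) _ _ t1.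
- move=> p; suff H n e : 0 < e ->
      \forall t \near (0 : R), \sum_(k < n) F k (t * p`_k) < e.
    move=> e e0; near=> t.
    rewrite (coefwise_sum_widen F0 (size_scale_leq t p)).
    by under eq_bigr do rewrite coefZ; near: t; exact: H.
  elim: n e => [|n IH] e e0; first by near=> t; rewrite big_ord0.
  have e20 : 0 < e / 2 by lra.
  near=> t; rewrite big_ord_recr/=.
  have : \sum_(k < n) F k (t * p`_k) < e / 2 by near: t; exact: IH.
  have : F n (t * p`_n) < e / 2 by near: t; exact: fseminorm_absorb (FP n) _ _ e20.
  lra.
Unshelve. all: by end_near. Qed.

Lemma coefwise_sum_ge F p k : (forall k a, 0 <= F k a) -> (forall k, F k 0 = 0) ->
  F k p`_k <= coefwise_sum F p.
Proof.
move=> Fge0 F0; rewrite (coefwise_sum_widen F0 (leq_maxl (size p) k.+1)).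
have kn : (k < maxn (size p) k.+1)%N by rewrite leq_max ltnSn orbT.
by rewrite (bigD1 (Ordinal kn))//= lerDl sumr_ge0.
Qed.

Lemma coefwise_sumD F1 F2 p :
  coefwise_sum F1 p + coefwise_sum F2 p = coefwise_sum (fun k a => F1 k a + F2 k a) p.
Proof. by rewrite /coefwise_sum big_split. Qed.

Lemma le_coefwise_sum F1 F2 p : (forall k a, F1 k a <= F2 k a) ->
  coefwise_sum F1 p <= coefwise_sum F2 p.
Proof. by move=> F12; exact: ler_sum. Qed.

End coefwise_sum.

(** The linear maps out of [{poly R}] are determined by the images of the
monomials, which can be prescribed freely. *)
Section lincomb.
Context {R : realType} {G : lmodType R} (u : nat -> G).
Implicit Types p q : {poly R}.

Definition lincomb (p : {poly R}) : G := \sum_(k < size p) p`_k *: u k.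

Lemma lincomb_widen p n : (size p <= n)%N ->
  lincomb p = \sum_(k < n) p`_k *: u k.
Proof.
move=> pn; rewrite /lincomb (big_ord_widen n (fun k => p`_k *: u k) pn).
rewrite big_mkcond; apply: eq_bigr => k _; case: ltnP => // pk.
by rewrite nth_default// scale0r.
Qed.

Lemma lincomb_linear : linear lincomb.
Proof.
move=> t p q; set n := maxn (size p) (size q).
rewrite (@lincomb_widen p n) ?leq_maxl// (@lincomb_widen q n) ?leq_maxr//.
rewrite (@lincomb_widen _ n); last first.
  rewrite (leq_trans (size_polyD _ _))// geq_max leq_maxr andbT.
  by rewrite (leq_trans (size_scale_leq _ _))// leq_maxl.
rewrite scaler_sumr -big_split/=; apply: eq_bigr => k _.
by rewrite coefD coefZ scalerDl scalerA.
Qed.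

Lemma lincombXn n : lincomb 'X^n = u n.
Proof.
rewrite /lincomb size_polyXn big_ord_recr/= coefXn eqxx scale1r big1 ?add0r//.
by move=> k _; rewrite coefXn ltn_eqF ?scale0r.
Qed.

End lincomb.

Lemma linear_lincomb {R : realType} {G : lmodType R} (f : {poly R} -> G) :
  linear f -> f = lincomb (fun n => f 'X^n).
Proof.
move=> lf; apply/funext => p.
have fD : {morph f : x y / x + y}.
  by move=> x y; rewrite -[x in LHS]scale1r lf scale1r.
have f0 : f 0 = 0 by apply: (@addrI _ (f 0)); rewrite -fD !addr0.
have fZ t x : f (t *: x) = t *: f x by rewrite -[in LHS](addr0 (t *: x)) lf f0 addr0.
rewrite -[in LHS](coefK p) poly_def (big_morph f fD f0).
by apply: eq_bigr => k _; rewrite fZ.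
Qed.

(** * The box topology on finitely supported sequences *)

Section box.
Context {R : realType}.
Implicit Types (c : nat -> R) (p : {poly R}).

Definition box_seminorm c : {poly R} -> R := coefwise_sum (fun k a => c k * `|a|).

Lemma fseminorm_box c : (forall k, 0 <= c k) -> fseminorm (box_seminorm c).
Proof.
move=> c0; apply: fseminorm_coefwise_sum => k.
exact: fseminorm_scale (c0 k) (fseminorm_norm R).
Qed.

Lemma box_seminormD c d p :
  box_seminorm c p + box_seminorm d p = box_seminorm (fun k => c k + d k) p.
Proof. by rewrite coefwise_sumD; apply: eq_bigr => k _; rewrite mulrDl. Qed.

Definition box_family : @fseminorm_family R {poly R}.
Proof.
refine (@FSeminormFamily R {poly R}
  [set q | exists2 c, (forall k, 0 <= c k) & q = box_seminorm c] _ _ _).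
- by move=> _ [c c0 ->]; exact: fseminorm_box.
- by exists (box_seminorm (fun=> 0)); exists (fun=> 0).
- move=> _ _ [c c0 ->] [d d0 ->]; exists (box_seminorm (fun k => c k + d k)).
    by exists (fun k => c k + d k) => // k; rewrite addr_ge0.
  by move=> p; rewrite box_seminormD.
Defined.

Lemma box_seminorm_ge c p k : (forall k, 0 <= c k) ->
  c k * `|p`_k| <= box_seminorm c p.
Proof.
move=> c0; apply: (@coefwise_sum_ge _ (fun k a => c k * `|a|)).
  by move=> n a; rewrite mulr_ge0.
by move=> n; rewrite normr0 mulr0.
Qed.

Lemma box_space_hausdorff : hausdorff_space (fspace box_family).
Proof.
apply: fspace_hausdorff => p small; apply/polyP => k; rewrite coef0.
apply/eqP; rewrite -normr_eq0; apply/negPn/negP => pk.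
have c0 (n : nat) : 0 <= `|p`_k|^-1 by rewrite invr_ge0.
have := @box_seminorm_ge (fun=> `|p`_k|^-1) p k c0.
rewrite mulVf//; apply/negP; rewrite -ltNge; apply: small.
by exists (fun=> `|p`_k|^-1).
Qed.

End box.

Notation box_space R := (fspace (@box_family R)).

Lemma box_seminormZ {R : realType} (c : nat -> R) t (p : {poly R}) :
  box_seminorm c (t *: p) = `|t| * box_seminorm c p.
Proof.
rewrite /box_seminorm (@coefwise_sum_widen _ _ _ (size p)) ?size_scale_leq//; last first.
  by move=> k; rewrite normr0 mulr0.
rewrite mulr_sumr; apply: eq_bigr => k _.
by rewrite coefZ normrM mulrCA.
Qed.

Lemma halving (G : topologicalZmodType) (A : set G) : nbhs 0 A ->
  exists2 B, nbhs 0 B & forall x y, B x -> B y -> A (x + y).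
Proof.
move=> A0; have := @add_continuous G (0, 0); rewrite /continuous_at/= addr0.
move=> /(_ A A0)[[B C]/= [B0 C0] BCA]; exists (B `&` C); first exact: filterI.
by move=> x y [Bx _] [_ Cy]; exact: (BCA (x, y)).
Qed.

(** The box topology is the finest vector topology on [{poly R}]. Given a
neighbourhood [W 0] of the origin in [G], choose [W n.+1 + W n.+1] inside [W n].
A weight [c n] forces the [n]-th term of a linear combination into [W n.+1], and
then every finite sum of terms lies in [W 0]. *)
Lemma box_space_finest {R : realType} (G : topologicalLmodType R) (u : nat -> G) :
  continuous (lincomb u : box_space R -> G).
Proof.
move=> p A nA.
have nA0 : nbhs 0 [set y | A (lincomb u p + y)].
  have := @add_continuous G (lincomb u p, 0); rewrite /continuous_at/= addr0.
  move=> /(_ A nA)[[B C]/= [B0 C0] BCA]; apply: filterS C0 => y Cy.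
  by apply: (BCA (_, y)); split=> //=; exact: nbhs_singleton.
pose st := {B : set G | nbhs 0 B}.
have next (B : st) : {C : st | forall x y, sval C x -> sval C y -> sval B (x + y)}.
  apply: cid; case: B => B /= /halving[C C0 CB]; by exists (exist _ C C0).
pose W n : st := iter n (fun B => sval (next B)) (exist _ _ nA0).
have WD n x y : sval (W n.+1) x -> sval (W n.+1) y -> sval (W n) (x + y).
  exact: svalP (next (W n)) x y.
have W0 n : sval (W n) 0 by apply: nbhs_singleton; exact: svalP (W n).
have absorb n : exists2 c : R, 0 < c &
    forall t, c * `|t| < 1 -> sval (W n.+1) (t *: u n).
  have := @scale_continuous R G (0, u n); rewrite /continuous_at/= scale0r.
  move=> /(_ _ (svalP (W n.+1)))[[B C]/= [/nbhs_ballP[d /= d0 dB] C0] BCW].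
  exists d^-1 => [|t]; first by rewrite invr_gt0.
  rewrite mulrC ltr_pdivrMr// mul1r => td; apply: (BCW (t, u n)).
  by split=> /=; [apply: dB; rewrite /ball/= sub0r normrN|exact: nbhs_singleton].
pose c n := s2val (cid2 (absorb n)).
have c0 n : 0 <= c n by rewrite ltW// /c; case: cid2.
have cP n t : c n * `|t| < 1 -> sval (W n.+1) (t *: u n).
  by rewrite /c; case: cid2 => d /= _; exact.
exists (box_seminorm c); first by exists c.
move=> q; rewrite /fball/= => qp1.
have -> : q = p + (q - p) :> {poly R} by rewrite addrC subrK.
rewrite -[p as X in X + _]scale1r lincomb_linear scale1r.
(* Generalised to sums starting at m, which stay in W m, for the induction. *)
suff sumW m n (r : {poly R}) : box_seminorm c r < 1 ->
    sval (W m) (\sum_(m <= k < m + n) r`_k *: u k).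
  by have := sumW 0 (size (q - p)) _ qp1; rewrite add0n big_mkord.
move=> r1; elim: n m => [|n IH] m; first by rewrite addn0 big_geq.
rewrite big_ltn; last by rewrite addnS ltnS leq_addr.
rewrite addnS -addSn; apply: WD => //; apply: cP.
exact: le_lt_trans (box_seminorm_ge _ _ c0) r1.
Qed.

(** * The free topological vector space on the natural numbers *)

Lemma box_ball_open {R : realType} (c : nat -> R) (p : box_space R) :
  (forall k, 0 <= c k) -> open (fball (box_seminorm c) p).
Proof.
move=> c0; rewrite openE => q pq; set e := 1 - box_seminorm c (q - p).
have e0 : 0 < e by rewrite subr_gt0.
exists (box_seminorm (fun k => e^-1 * c k)).
  by exists (fun k => e^-1 * c k) => // k; rewrite mulr_ge0// invr_ge0 ltW.
move=> r; rewrite /fball/=.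
have -> : box_seminorm (fun k => e^-1 * c k) (r - q) = e^-1 * box_seminorm c (r - q).
  by rewrite mulr_sumr; apply: eq_bigr => k _; rewrite mulrA.
rewrite mulrC ltr_pdivrMr// mul1r /e.
have := fseminormD (fseminorm_box c0) (r - q) (q - p); rewrite addrA subrK; lra.
Qed.

Lemma box_ball_convex {R : realType} (c : nat -> R) (p : box_space R) :
  (forall k, 0 <= c k) -> convex_set (fball (box_seminorm c) p).
Proof.
move=> c0; apply/convex_setW => x y; rewrite !inE /fball/= => px py l l0 l1.
rewrite inE/=.
have -> : (conv l x y : box_space R) - p
    = l%:num *: (x - p) + (1 - l%:num) *: (y - p).
  by rewrite !scalerBr addrACA -opprD -(scalerDl p) [l%:num + _]addrC subrK scale1r.
have := fseminormD (fseminorm_box c0) (l%:num *: (x - p)) ((1 - l%:num) *: (y - p)).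
rewrite !box_seminormZ (ger0_norm (ltW l0)) (@ger0_norm _ (1 - _)); last by lra.
nra.
Qed.

Lemma convex_set_preimage {R : realType} (E F : lmodType R) (f : E -> F)
    (A : set F) :
  linear f -> convex_set A -> convex_set (f @^-1` A).
Proof.
move=> lf cA x y l; rewrite !inE/= => Ax Ay.
have fZ t z : f (t *: z) = t *: f z.
  have f0 : f 0 = 0 by have := lf (-1) 0 0; rewrite !scaleN1r oppr0 !addr0 addNr.
  by rewrite -[in LHS](addr0 (t *: z)) lf f0 addr0.
have := @cA (f x) (f y) l; rewrite !inE => /(_ Ax Ay).
by congr (A _); rewrite [RHS]lf fZ.
Qed.

Section free_on_nat.
Context {R : realType} {phi : topologicalLmodType R} {j : nat -> phi}.
Hypothesis freej : is_free_tvs j.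

(** The universal property of [phi] gives a map to the box space sending [j n] to
['X^n]; the finest topology of the box space makes the map in the other
direction continuous. They are inverse to each other on [phi] by the uniqueness
in the universal property, and on [{poly R}] by linearity. *)
Lemma free_nat_box_iso : exists g : phi -> box_space R,
  [/\ linear g, continuous g, cancel g (lincomb j),
      cancel (lincomb j : box_space R -> phi) g & forall n, g (j n) = 'X^n].
Proof.
case: freej => hphi cj ext.
have cX : continuous (fun n => 'X^n : box_space R).
  move=> n A nA; suff : nbhs n ((fun n => 'X^n : box_space R) @^-1` A) by [].
  rewrite nbhs_principalE; apply/principal_filterP.
  exact: (@nbhs_singleton (box_space R) _ _ nA).
have [g [[lg cg gj] _]] := ext _ _ (@box_space_hausdorff R) cX.
have gjn n : g (j n) = 'X^n by rewrite -[LHS]/((g \o j) n) -gj.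
have [h [_ uniq]] := ext _ _ hphi cj.
exists g; split=> //.
- suff E : lincomb j \o g = id by move=> x; exact: (congr1 (fun f => f x) E).
  rewrite -(uniq id); last by split=> // x; exact: cvg_id.
  apply/esym/uniq; split.
  + by move=> t x y; rewrite /= lg lincomb_linear.
  + by move=> x; apply: continuous_comp; [exact: cg|exact: box_space_finest].
  + by apply/funext => n /=; rewrite gjn lincombXn.
- move=> p; rewrite -[LHS]/((g \o lincomb j) p).
  have lgj : linear (g \o lincomb j : {poly R} -> {poly R}).
    by move=> t x y; rewrite /= lincomb_linear lg.
  rewrite (linear_lincomb lgj)/=.
  under [X in lincomb X]eq_fun do rewrite lincombXn gjn.
  by rewrite -(@linear_lincomb R _ id).
Qed.

(** A free topological vector space that happens to be locally convex is free
among locally convex spaces, and [phi] inherits the convex balls of the box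
space. *)
Lemma free_nat_lcs : is_free_lcs j.
Proof.
case: (freej) => hphi cj ext; split=> //; last by move=> E f [hE _]; exact: ext.
split=> //; have [g [lg cg gK Kg _]] := free_nat_box_iso.
exists [set b | exists c p, (forall k, 0 <= c k) /\
    b = g @^-1` (fball (box_seminorm c) p)].
  move=> b; rewrite inE => -[c [p [c0 ->]]].
  exact/(convex_set_preimage lg)/box_ball_convex.
split.
  move=> _ [c [p [c0 ->]]].
  by apply: open_comp => [x _|]; [exact: cg|exact: box_ball_open].
move=> x A nA.
have := @box_space_finest R _ j (g x) A; rewrite gK => /(_ nA)[_ [c c0 ->] cA].
exists (g @^-1` fball (box_seminorm c) (g x)).
  split; first by exists c, (g x).
  by apply: fball_center; exists c.
by move=> y /= /cA/=; rewrite gK.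
Qed.

End free_on_nat.

(** * The block space *)

(** The indices are cut into consecutive blocks [2^n - 1 <= k < 2^(n+1) - 1] of
length [2^n]. The block of [k] is numbered [block k]. *)
Definition block (k : nat) : nat := trunc_log 2 k.+1.

Lemma block_eq k n : (block k == n) = ((2 ^ n).-1 <= k < (2 ^ n.+1).-1)%N.
Proof.
rewrite -ltnS prednK ?expn_gt0// -[(k < _)%N]ltnS prednK ?expn_gt0//.
apply/eqP/idP => [<-|]; last exact: trunc_log_eq.
exact: trunc_log_bounds.
Qed.

Lemma block_predXn n : block (2 ^ n).-1 = n.
Proof. by rewrite /block prednK ?expn_gt0// trunc_expnK. Qed.

Lemma leq_block s k : ((2 ^ s).-1 <= k)%N -> (s <= block k)%N.
Proof. by move=> sk; rewrite -(block_predXn s); apply: leq_trunc_log. Qed.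

(** The weight [2^-n] is the inverse of the length of the [n]-th block. *)
Lemma sum_blocks (R : realType) (F : nat -> R) s :
  \sum_(k < (2 ^ s).-1) (2 ^+ block k)^-1 * F (block k) = \sum_(n < s) F n.
Proof.
rewrite -(big_mkord xpredT (fun k => (2 ^+ block k)^-1 * F (block k))).
elim: s => [|s IH]; first by rewrite big_ord0 big_geq.
have le : ((2 ^ s).-1 <= (2 ^ s.+1).-1)%N.
  by rewrite -!subn1 leq_sub2r// leq_pexp2l.
rewrite (@big_cat_nat _ _ _ (2 ^ s).-1)//= IH big_ord_recr/=; congr (_ + _).
rewrite (eq_big_nat _ _ (F2 := fun=> (2 ^+ s)^-1 * F s)); last first.
  by move=> k; rewrite -block_eq => /eqP ->.
rewrite sumr_const_nat.
have -> : ((2 ^ s.+1).-1 - (2 ^ s).-1 = 2 ^ s)%N.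
  by have := expn_gt0 2 s; rewrite expnS; lia.
by rewrite -[LHS]mulr_natl mulrA natrX divff ?mul1r// expf_neq0// pnatr_eq0.
Qed.

Definition block_sum {G : zmodType} (u : nat -> G) n : G :=
  \sum_((2 ^ n).-1 <= k < (2 ^ n.+1).-1) u k.

Section spread.
Context {R : realType}.
Implicit Types (p y : {poly R}) (c : nat -> R).

Lemma coef_block_sumXn n k :
  (block_sum (fun l => 'X^l : {poly R}) n)`_k = (block k == n)%:R.
Proof.
rewrite /block_sum coef_sum; under eq_bigr do rewrite coefXn.
rewrite block_eq -mem_index_iota; case: (boolP (k \in _)) => kI.
  rewrite (bigD1_seq k)//= ?iota_uniq// eqxx big1 ?addr0// => l lk.
  by rewrite eq_sym (negPf lk).
rewrite big1_seq// => l /andP[_ lI]; case: eqP => // kl.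
by rewrite kl lI in kI.
Qed.

(** Copies the [n]-th coefficient to all positions of the [n]-th block. *)
Definition spread : {poly R} -> {poly R} := lincomb (block_sum (fun k => 'X^k)).

Lemma coef_spread p k : (spread p)`_k = p`_(block k).
Proof.
rewrite -[in RHS](coefK p) poly_def !coef_sum; apply: eq_bigr => n _.
by rewrite !coefZ coef_block_sumXn coefXn.
Qed.

(** The first position of every block is read. The size of [y] is a sufficient
bound because the [n]-th block starts at or after [n]. *)
Definition unspread y : {poly R} := \poly_(n < size y) y`_(2 ^ n).-1.

Lemma coef_unspread y n : (unspread y)`_n = y`_(2 ^ n).-1.
Proof.
rewrite coef_poly; case: ltnP => // yn; rewrite nth_default//.
by rewrite (leq_trans yn)// -ltnS prednK ?expn_gt0// ltn_expl.
Qed.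

Lemma spreadK : cancel spread unspread.
Proof.
by move=> p; apply/polyP => n; rewrite coef_unspread coef_spread block_predXn.
Qed.

Lemma spread_range y :
  (forall k l, block k = block l -> y`_k = y`_l) -> spread (unspread y) = y.
Proof.
move=> yb; apply/polyP => k; rewrite coef_spread coef_unspread; apply: yb.
exact: block_predXn.
Qed.

(** The factor [c n] may be as large as desired, and yet a single coordinate of
the [n]-th block contributes at most [r * 2^-n], so that the contribution of any
one coordinate tends to zero. On a sequence that is constant on the blocks the
[2^n] coordinates together contribute [r * min (c n * |a|) 1], which does detect
whether [|a| < 1 / c n]. *)
Definition block_seminorm r c : {poly R} -> R :=
  coefwise_sum (fun k a =>
    r / 2 ^+ block k * Num.min (c (block k) * `|a|) 1).

Let weight_ge0 r k : 0 <= r -> 0 <= r / 2 ^+ block k :> R.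
Proof. by move=> r0; rewrite mulr_ge0// invr_ge0 exprn_ge0. Qed.

Lemma fseminorm_block r c : 0 <= r -> (forall n, 0 <= c n) ->
  fseminorm (block_seminorm r c).
Proof.
move=> r0 c0; apply: fseminorm_coefwise_sum => k.
apply: (@fseminorm_scale R R^o _ _ (weight_ge0 k r0)).
exact: (fseminorm_min1 (fseminorm_scale (c0 _) (fseminorm_norm R))).
Qed.

Lemma block_seminormD r s c d p :
  0 <= r -> 0 <= s -> (forall n, 0 <= c n) -> (forall n, 0 <= d n) ->
  block_seminorm r c p + block_seminorm s d p <=
  block_seminorm (r + s) (fun n => c n + d n) p.
Proof.
move=> r0 s0 c0 d0; rewrite coefwise_sumD; apply: le_coefwise_sum => k a.
rewrite 2!mulrDl; apply: lerD; apply: ler_wpM2l; rewrite ?weight_ge0//.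
  have := c0 (block k); have := d0 (block k); have := normr_ge0 a.
  by move=> a0 dk ck; apply: le_min2 => //; nra.
have := c0 (block k); have := d0 (block k); have := normr_ge0 a.
by move=> a0 dk ck; apply: le_min2 => //; nra.
Qed.

Definition block_family : @fseminorm_family R {poly R}.
Proof.
refine (@FSeminormFamily R {poly R} [set q | exists r c,
  [/\ 0 <= r, forall n, 0 <= c n & q = block_seminorm r c]] _ _ _).
- by move=> _ [r [c [r0 c0 ->]]]; exact: fseminorm_block.
- by exists (block_seminorm 0 (fun=> 0)); exists 0, (fun=> 0); split.
- move=> _ _ [r [c [r0 c0 ->]]] [s [d [s0 d0 ->]]].
  exists (block_seminorm (r + s) (fun n => c n + d n)).
    exists (r + s), (fun n => c n + d n); split=> //; first exact: addr_ge0.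
    by move=> n; exact: addr_ge0.
  by move=> p; exact: block_seminormD.
Defined.

Lemma block_seminorm_ge r c p k : 0 <= r -> (forall n, 0 <= c n) ->
  r / 2 ^+ block k * Num.min (c (block k) * `|p`_k|) 1 <= block_seminorm r c p.
Proof.
move=> r0 c0; apply: (@coefwise_sum_ge _
  (fun k a => r / 2 ^+ block k * Num.min (c (block k) * `|a|) 1)).
  by move=> n a; rewrite mulr_ge0 ?weight_ge0// le_min ler01 mulr_ge0.
by move=> n; rewrite normr0 mulr0 min_l// mulr0.
Qed.

Lemma block_seminorm_spread c p :
  block_seminorm 1 c (spread p) = \sum_(n < size p) Num.min (c n * `|p`_n|) 1.
Proof.
rewrite /block_seminorm (@coefwise_sum_widen _ _ _ (2 ^ size p).-1).
- rewrite -(sum_blocks (fun n => Num.min (c n * `|p`_n|) 1)); apply: eq_bigr => k _.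
  by rewrite coef_spread mul1r.
- by move=> k; rewrite normr0 mulr0 min_l// mulr0.
- by apply/leq_sizeP => k /leq_block pk; rewrite coef_spread nth_default.
Qed.

End spread.

Notation block_space R := (fspace (@block_family R)).

Section spread_topology.
Context {R : realType}.

Lemma block_space_near_coef (y : block_space R) k e : 0 < e ->
  \forall z \near y, `|(z : {poly R})`_k - (y : {poly R})`_k| < e.
Proof.
move=> e0; have c0 (n : nat) : 0 <= e^-1 by rewrite invr_ge0 ltW.
have r0 : 0 <= 2 ^+ block k :> R by rewrite exprn_ge0.
exists (block_seminorm (2 ^+ block k) (fun=> e^-1)).
  by exists (2 ^+ block k), (fun=> e^-1).
move=> z; rewrite /fball/= => /(le_lt_trans (block_seminorm_ge _ k r0 c0)).
rewrite divff ?expf_neq0 ?pnatr_eq0// mul1r gt_min ltxx orbF.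
by rewrite mulrC ltr_pdivrMr// mul1r coefB.
Qed.

Lemma block_space_hausdorff : hausdorff_space (block_space R).
Proof.
apply: fspace_hausdorff => p small; apply/polyP => k; rewrite coef0.
apply/eqP; rewrite -normr_eq0; apply/negPn/negP => pk.
have pk0 : 0 < `|p`_k| by rewrite lt_def pk/=.
have [q Pq qP] := block_space_near_coef (0 : block_space R) k pk0.
have := qP p; rewrite /fball/= subr0 => /(_ (small q Pq)).
by rewrite coef0 subr0 ltxx.
Qed.

(** The range consists of the sequences that are constant on every block, and the
coordinates are continuous. *)
Lemma closed_range_spread : closed (range (spread : _ -> block_space R)).
Proof.
move=> y cly; exists (unspread y) => //; apply: spread_range => k l bkl.
apply/eqP; rewrite -subr_eq0 -normr_le0; apply/ler_addgt0Pr => e e0.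
have e20 : 0 < e / 2 by lra.
have [_ [[p _ <-] [pk pl]]] := cly _ (filterI
  (block_space_near_coef y k e20) (block_space_near_coef y l e20)).
move: pk pl; rewrite !coef_spread bkl distrC => pk pl.
have := ler_normD (y`_k - p`_(block l)) (p`_(block l) - y`_l).
rewrite addrA subrK; lra.
Qed.

(** A neighbourhood of [p] for the box topology is detected after spreading: if
the sum of the [min (c n * |a n|) 1] is less than 1, then no minimum is attained
at 1, and the sum is the box seminorm itself. *)
Lemma spread_embedding (p : box_space R) A : nbhs p A ->
  exists2 M, nbhs (spread p : block_space R) M &
    forall q, M (spread q) -> A q.
Proof.
move=> [_ [c c0 ->] cA].
exists (fball (block_seminorm 1 c) (spread p : block_space R)).
  by exists (block_seminorm 1 c) => //; exists 1, c.
move=> q; rewrite /fball/= => qp; apply: cA; rewrite /fball/=.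
have spreadB : spread q - spread p = spread (q - p).
  by apply/polyP => k; rewrite coefB !coef_spread coefB.
rewrite spreadB block_seminorm_spread in qp.
have min_ge0 n : 0 <= Num.min (c n * `|(q - p)`_n|) 1.
  by rewrite le_min ler01 mulr_ge0.
suff <- : \sum_(n < size (q - p)) Num.min (c n * `|(q - p)`_n|) 1
    = box_seminorm c (q - p) by [].
apply: eq_bigr => n _; apply: min_l; rewrite leNgt; apply/negP => big.
move: qp; apply/negP; rewrite -leNgt (bigD1 n)//= min_r ?(ltW big)//.
by rewrite lerDl sumr_ge0.
Qed.

End spread_topology.

(** * Bump functions as a map to the block space *)

Lemma block_seminormXn {R : realType} r (c : nat -> R) a n : 0 <= r ->
  block_seminorm r c (a *: 'X^n) <= r / 2 ^+ block n.
Proof.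
move=> r0; rewrite /block_seminorm (@coefwise_sum_widen _ _ _ n.+1); last 2 first.
- by move=> k; rewrite normr0 mulr0 min_l// mulr0.
- by rewrite (leq_trans (size_scale_leq _ _))// size_polyXn.
rewrite big_ord_recr/= big1 ?add0r => [|k _].
  by rewrite ler_piMr ?mulr_ge0 ?invr_ge0 ?exprn_ge0// ge_min lexx orbT.
by rewrite coefZ coefXn ltn_eqF// mulr0 normr0 mulr0 min_l// mulr0.
Qed.

(** Continuity at a point is a uniform approximation. The first [K] coordinates
form a finite sum of continuous functions; the remaining part of [f y] is at most
one monomial of index at least [K], whose F-seminorm is at most [r * 2^-N]
however large its coefficient. *)
Lemma bumps_to_block_space {R : realType} {X : topologicalType}
    (g : nat -> X -> R) :
  (forall n, continuous (g n)) ->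
  (forall m n y, g m y != 0 -> g n y != 0 -> m = n) ->
  exists2 f : X -> block_space R,
    continuous f & forall y k, (f y : {poly R})`_k = g k y.
Proof.
move=> cg disj.
have supp y : {n | forall k, k != n -> g k y = 0}.
  apply: cid; have [[n gn]|no] := pselect (exists n, g n y != 0).
    exists n => k kn; apply/eqP/negPn/negP => gk.
    by move/eqP: kn; apply; exact: disj gk gn.
  exists 0%N => k _; apply/eqP/negPn/negP => gk; apply: no; by exists k.
(* The only index that can support the value at y; 0 if there is none. *)
pose n y := sval (supp y).
have g0 y k : k != n y -> g k y = 0 by exact: svalP (supp y) k.
pose f y : {poly R} := g (n y) y *: 'X^(n y).
have coef_f y k : (f y)`_k = g k y.
  rewrite coefZ coefXn; have [->|kn] := eqVneq k (n y); first by rewrite mulr1.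
  by rewrite mulr0 g0.
exists f => // x A [_ [r [c [r0 c0 ->]]] qA].
have qF := fseminorm_block r0 c0; set q := block_seminorm r c in qA qF.
have [N rN] : exists N, r / 2 ^+ N < 4^-1.
  exists (Num.bound (4 * r)); rewrite ltr_pdivrMr ?exprn_gt0//.
  have := @archi_boundP R (4 * r); rewrite mulr_ge0// => /(_ isT) rb.
  have : (Num.bound (4 * r))%:R <= 2 ^+ Num.bound (4 * r) :> R.
    by rewrite -natrX ler_nat ltnW// ltn_expl.
  lra.
(* Coordinates from K on belong to blocks of number at least N. *)
pose K := (2 ^ N).-1.
pose head y : {poly R} := \poly_(k < K) g k y.
have tail y : q (f y - head y) < 4^-1.
  have [nK|Kn] := ltnP (n y) K.
    suff -> : f y - head y = 0 by rewrite (fseminorm0 qF).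
    apply/polyP => k; rewrite coefB coef_f coef_poly coef0.
    case: ltnP => [|Kk]; first by rewrite subrr.
    by rewrite subr0 g0// gtn_eqF// (leq_trans nK).
  have -> : f y - head y = f y.
    apply/polyP => k; rewrite coefB coef_f coef_poly.
    case: ltnP => [kK|]; last by rewrite subr0.
    by rewrite g0 ?subr0// ltn_eqF// (leq_trans kK).
  apply: le_lt_trans (block_seminormXn _ _ _ r0) _.
  apply: le_lt_trans rN; rewrite ler_wpM2l// lef_pV2 ?posrE ?exprn_gt0//.
  by rewrite ler_eXn2l ?ltr1n// leq_block.
have headc m e : 0 < e ->
    \forall y \near x, q (\sum_(k < m) (g k y - g k x) *: 'X^k) < e.
  elim: m e => [|m IH] e e0.
    by near=> y; rewrite big_ord0 (fseminorm0 qF).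
  have e20 : 0 < e / 2 by lra.
  have gm : (fun y => g m y - g m x) @ x --> (0 : R).
    by rewrite -[X in _ --> X](subrr (g m x)); apply: cvgB; [exact: cg|exact: cvg_cst].
  near=> y; rewrite big_ord_recr/=.
  have := fseminormD qF (\sum_(k < m) (g k y - g k x) *: 'X^k)
    ((g m y - g m x) *: 'X^m).
  have : q (\sum_(k < m) (g k y - g k x) *: 'X^k) < e / 2 by near: y; exact: IH.
  have : q ((g m y - g m x) *: 'X^m) < e / 2.
    by near: y; exact: gm (fseminorm_absorb qF 'X^m e20).
  lra.
have q4 : 0 < 4^-1 :> R by lra.
apply: filterS (headc K _ q4) => y hy; apply: qA; rewrite /fball/=.
have hE : head y - head x = \sum_(k < K) (g k y - g k x) *: 'X^k.
  by rewrite /head !poly_def -sumrB; apply: eq_bigr => k _; rewrite scalerBl.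
rewrite -hE in hy.
have -> : f y - f x = (head y - head x) + ((f y - head y) - (f x - head x)).
  by ring.
have := fseminormD qF (head y - head x) ((f y - head y) - (f x - head x)).
have := fseminormB qF (f y - head y) (f x - head x).
have := tail x; have := tail y; lra.
Unshelve. all: by end_near. Qed.

(** * The closed copy of the free space *)

Theorem theorem3p14 (R : realType) (X : topologicalType)
    (V : topologicalLmodType R) (i : X -> V)
    (phi : topologicalLmodType R) (j : nat -> phi) :
  tychonoff_space X -> infinite_set [set: X] ->
  is_free_tvs i -> is_free_tvs j ->
  is_free_lcs j /\
  exists W : set V,
    [/\ vector_subspace W, closed W & topologically_isomorphic_onto phi W].
Proof.
move=> tX infX [hV ci ext] freej; split; first exact: free_nat_lcs.
have [x [g [cg g1 gdisj]]] := disjoint_bumps R tX infX.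
have [f cf coef_f] := bumps_to_block_space cg gdisj.
have [theta [[ltheta ctheta ftheta] _]] :=
  ext _ f (@block_space_hausdorff R) cf.
have fx k : f (x k) = 'X^k.
  apply/polyP => l; rewrite coef_f coefXn.
  have [->|lk] := eqVneq l k; first exact: g1.
  apply/eqP/negPn/negP => gl; move/eqP: lk; apply.
  by apply: (gdisj l k (x k)) => //; rewrite g1 oner_eq0.
(* The generators of the subspace are sums of longer and longer blocks of points
   of X; theta sends them to the sequences constant on one block. *)
pose H : {poly R} -> V := lincomb (block_sum (i \o x)).
have linH : linear H by exact: lincomb_linear.
have thetaH : theta \o H = spread.
  have thetaD : {morph theta : u v / u + v}.
    by move=> u v; rewrite -[u in LHS]scale1r ltheta scale1r.
  have theta0 : theta 0 = 0 by apply: (@addrI _ (theta 0)); rewrite -thetaD !addr0.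
  have lin : linear (theta \o H : {poly R} -> {poly R}).
    by move=> t u v; rewrite /= linH ltheta.
  rewrite (linear_lincomb lin); congr lincomb; apply/funext => n /=.
  rewrite /H lincombXn /block_sum (big_morph theta thetaD theta0).
  by apply: eq_bigr => k _; rewrite /= -fx ftheta.
have thetaHE p : theta (H p) = spread p by rewrite -thetaH.
have [h [lh ch hK Kh _]] := free_nat_box_iso freej.
exists (range H); split.
- split; first by rewrite inE; exists 0 => //; rewrite /H /lincomb size_poly0 big_ord0.
  move=> t u v; rewrite !inE => -[p _ <-] [q _ <-].
  by exists (t *: p + q) => //; exact: linH.
(* A point y adherent to the range of H has theta y = spread p for some p. The
   points H q close to y have spread q close to spread p, hence q close to p, so
   that y cannot be separated from H p. *)
- move=> y cly.
  have [p _ pE] : range (spread : _ -> block_space R) (theta y).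
    apply: closed_range_spread => M /(ctheta y)/cly[_ [[p _ <-] Mp]].
    by exists (spread p); split; [exists p|rewrite -thetaHE].
  exists p => //; apply/esym/hV => A B nA nB.
  have [M nM MB] := spread_embedding (box_space_finest nB).
  rewrite pE in nM.
  have [_ [[q _ <-] [Aq Mq]]] := cly _ (filterI nA (ctheta _ _ nM)).
  by exists (H q); split=> //; apply: MB; rewrite -thetaHE.
(* The map unspread is discontinuous on the whole block space, but continuous on
   the closed subspace formed by the range of spread, where theta maps W. *)
- exists (H \o h), (lincomb j \o unspread \o theta); split.
  + by move=> t u v; rewrite /= lh linH.
  + by move=> u; apply: continuous_comp; [exact: ch|exact: box_space_finest].
  + apply/seteqP; split=> [_ [u _ <-]|_ [p _ <-]]; first by exists (h u).
    by exists (lincomb j p) => //=; rewrite Kh.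
  + by move=> u /=; rewrite thetaHE spreadK hK.
  + apply/subspace_continuousP => _ [p _ <-] A nA.
    have [M nM MA] : exists2 M, nbhs (spread p : block_space R) M &
        forall q, M (spread q) -> A (lincomb j q).
      apply: spread_embedding; apply: box_space_finest.
      by have := nA; rewrite -[X in nbhs X]/(lincomb j (unspread (theta (H p)))) thetaHE spreadK.
    have nM' : nbhs (H p) (theta @^-1` M).
      by rewrite -thetaHE in nM; exact: ctheta nM.
    apply: filterS nM' => u Mu [q _ qu].
    suff : A (lincomb j (unspread (theta u))) by [].
    by move: Mu; rewrite -qu /= thetaHE spreadK => /MA.
Qed.
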